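(* Let $K$ be a metric space, let $A$ be a non-clopen set in $\mathcal{D}(K)$, let $n=i(A)$, and set $f=\chi_A$. Then for $1\le m\le n$: $$\operatorname{osc}_mf(x)=j\ \text{ for all }x\in\partial^jA\setminus\partial^{j+1}A,\quad 0\le j<m,$$ $$\operatorname{osc}_mf(x)=m\ \text{ for all }x\in\partial^mA .$$
   Context: $\mathcal{D}(K)$ is the algebra of subsets of $K$ generated by the closed subsets of $K$. $\chi_A$ is the characteristic function of $A$. For $L\subset K$, $\partial_LA$ denotes the boundary of $A\cap L$ relative to the metric subspace $L$. Put $\partial^0A=K$ and $\partial^{n+1}A=\partial_LA$ where $L=\partial^nA$. The index $i(A)$ is the largest $n$ with $\partial^nA\ne\emptyset$ if there is such an $n$, and $\infty$ otherwise; it is finite for $A\in\mathcal{D}(K)$. Finite oscillations: $\operatorname{osc}_0f\equiv0$, $\widetilde{\operatorname{osc}}_{m+1}f(x)=\limsup_{y\to x}\bigl(|f(y)-f(x)|+\operatorname{osc}_mf(y)\bigr)$, and $\operatorname{osc}_{m+1}f(x)=\limsup_{y\to x}\widetilde{\operatorname{osc}}_{m+1}f(y)$, where all $\limsup$'s are non-exclusive (the point $y=x$ is allowed). *)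

(* Defs.v *)
From HB Require Import structures.
From mathcomp Require Import all_boot all_order all_algebra.
From mathcomp Require Import all_classical all_reals all_analysis.
Set Implicit Arguments.
Unset Strict Implicit.
Unset Printing Implicit Defensive.
Import Order.TTheory GRing.Theory Num.Theory.
Import numFieldNormedType.Exports.
Local Open Scope classical_set_scope.
Local Open Scope ring_scope.

Definition set_algebra {T : Type} (G : set (set T)) : Prop :=
  setring G /\ G setT.

(* The class D(K). *)
Definition closed_algebra (T : topologicalType) : set (set T) :=
  smallest set_algebra [set C : set T | closed C].

Definition boundary {T : topologicalType} (A : set T) : set T :=
  closure A `\` interior A.

(* In [subspace L] the points outside L are isolated, so that closure and
   interior of a subset of L there are those of the metric subspace L. *)
Definition rel_boundary {T : topologicalType} (L A : set T) : set T :=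
  @boundary (subspace L) (A `&` L).

Fixpoint iter_boundary {T : topologicalType} (A : set T) (n : nat) : set T :=
  if n is n'.+1 then rel_boundary (iter_boundary A n') A else setT.

Definition largest_nonempty {T : topologicalType} (A : set T) (n : nat) : Prop :=
  iter_boundary A n !=set0 /\
  forall k, iter_boundary A k !=set0 -> (k <= n)%N.

Definition boundary_index (R : realType) {T : topologicalType} (A : set T) :
    \bar R :=
  if pselect (exists n, largest_nonempty A n) is left h
  then (sval (cid h))%:R%:E else +oo%E.

(* [limf_esup _ (nbhs x)] is the non-exclusive limsup at x, since the
   neighbourhoods of x contain x.  With g the m-th oscillation of f,
   [osc_tilde f g] is the (m+1)-st tilde-oscillation of f. *)
Definition osc_tilde {R : realType} {K : metricType R} (f : K -> R)
    (g : K -> \bar R) (x : K) : \bar R :=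
  limf_esup (fun y => (`|f y - f x|%:E + g y)%E) (nbhs x).

Fixpoint osc {R : realType} {K : metricType R} (f : K -> R) (m : nat)
    (x : K) : \bar R :=
  if m is m'.+1 then limf_esup (osc_tilde f (osc f m')) (nbhs x) else 0%E.

(* Main.v *)
Require Import Defs.
From HB Require Import structures.
From mathcomp Require Import all_boot all_order all_algebra.
From mathcomp Require Import all_classical all_reals all_analysis.
Import Order.TTheory GRing.Theory Num.Theory.
Import numFieldNormedType.Exports.
Local Open Scope classical_set_scope.
Local Open Scope ring_scope.

(** By induction on [m], [osc_m \1_A] is the rank of a point in the decreasing
    chain of closed sets [iter_boundary A j], truncated at [m]. If x lies in
    [iter_boundary A m.+1], there are y in [iter_boundary A m] arbitrarily close
    to x with [`|\1_A y - \1_A x| = 1], so the next oscillation is at least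
    [m + 1]. If x is not in [iter_boundary A j.+1], then near x either y has left
    [iter_boundary A j], which lowers the previous oscillation by one, or
    [\1_A y = \1_A x]; either way the sum is at most [j]. *)

Section extended_limsup.
Context {R : realType} {T : choiceType} {X : filteredType T}.
Implicit Types (F : set (set X)) (f : X -> \bar R) (c : \bar R).
Local Open Scope ereal_scope.

Lemma limf_esup_le F f c : F [set y | f y <= c] -> limf_esup f F <= c.
Proof.
move=> fc; apply: (@le_trans _ _ (ereal_sup (f @` [set y | f y <= c]))).
  by apply: ereal_inf_lbound; exists [set y | f y <= c].
by apply: ge_ereal_sup => _ [y /= fy <-].
Qed.

Lemma limf_esup_ge F f c :
  (forall V, F V -> exists2 y, V y & c <= f y) -> c <= limf_esup f F.
Proof.
move=> cf; apply: le_ereal_inf_tmp => _ [V FV <-].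
have [y Vy cy] := cf _ FV; apply: le_trans cy _.
by apply: ereal_sup_ubound; exists y.
Qed.

End extended_limsup.

Lemma ge_limf_esup_nbhs {R : realType} {T : topologicalType} (f : T -> \bar R)
  (x : T) : (f x <= limf_esup f (nbhs x))%E.
Proof. by apply: limf_esup_ge => V /nbhs_singleton Vx; exists x. Qed.

Section iterated_boundary.
Context {T : topologicalType}.
Implicit Types (A L : set T) (x : T).

(** Replacing the interior by the complement of a closure treats [A] and its complement alike:
    closedness and approach from both sides can be read off. *)
Lemma rel_boundaryE L A :
  rel_boundary L A = L `&` closure (A `&` L) `&` closure (L `\` A).
Proof.
rewrite /rel_boundary /boundary closure_subspaceW; last exact: subIsetr.
apply/seteqP; split => [x [[clx Lx] nint]|x [[Lx clx] clCx]].
- split=> // B xB; apply: contrapT => LAB0; apply: nint.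
  (* As [B] misses [L \ A], this neighbourhood of x has the same trace on [L] as [A]. *)
  apply/nbhs_subspace_ex => //; exists (A `|` B).
    by apply: filterS xB => y; right.
  apply/seteqP; split => [y [[Ay Ly] _]|y [AB Ly]]; split => //; first by left.
  case: AB => [//|By]; split=> //.
  by apply: contrapT => nAy; apply: LAB0; exists y.
- split=> //; rewrite /interior /= => /nbhs_subspace_ex-/(_ Lx) [V xV AV].
  have [y [[Ly nAy] Vy]] := clCx _ xV.
  have [] : ((A `&` L) `&` L) y by rewrite AV.
  by case.
Qed.

Lemma closed_iter_boundary A j : closed (iter_boundary A j).
Proof.
elim: j => [|j IHj]; first exact: closedT.
rewrite /= rel_boundaryE; apply: closedI; last exact: closed_closure.
by apply: closedI => //; exact: closed_closure.
Qed.

Lemma near_notin_iter_boundary {A j x} : ~ iter_boundary A j x ->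
  \forall y \near x, ~ iter_boundary A j y.
Proof.
move=> xj; apply: open_nbhs_nbhs; split=> //.
exact/closed_openC/closed_iter_boundary.
Qed.

Lemma iter_boundaryS_indic {R : realType} {A j x} {V : set T} :
  iter_boundary A j.+1 x -> nbhs x V ->
  exists2 y, V y /\ iter_boundary A j y & `|\1_A y - \1_A x| = 1 :> R.
Proof.
rewrite /= rel_boundaryE => -[[_ clA] clCA] xV.
have [Ax|nAx] := pselect (A x).
  have [y [[jy nAy] Vy]] := clCA _ xV; exists y => //.
  by rewrite !indicE (memNset nAy) (mem_set Ax) sub0r normrN1.
have [y [[Ay jy] Vy]] := clA _ xV; exists y => //.
by rewrite !indicE (mem_set Ay) (memNset nAx) subr0 normr1.
Qed.

(** x is in the closure of its own side of [iter_boundary A j], so it must avoid the closure of the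
    other side, whose complement is then a neighbourhood. *)
Lemma near_indic_iter_boundary {R : realType} A j x :
  iter_boundary A j x -> ~ iter_boundary A j.+1 x ->
  \forall y \near x, iter_boundary A j y -> \1_A y = \1_A x :> R.
Proof.
rewrite /= rel_boundaryE => jx /not_andP nx.
have [Ax|nAx] := pselect (A x).
- case: nx => [nx|].
    by case: nx; split=> //; apply: subset_closure.
  rewrite -[~ _]/((~` closure _) x) -interiorC => nx.
  near=> y => jy; rewrite !indicE (mem_set Ax) mem_set//.
  apply: contrapT => nAy.
  by have /(_ (conj jy nAy)) : (~` (iter_boundary A j `\` A)) y by near: y.
- case: nx => [/not_andP[//|]|nx]; last first.
    by case: nx; apply: subset_closure.
  rewrite -[~ _]/((~` closure _) x) -interiorC => nx.
  near=> y => jy; rewrite !indicE (memNset nAx) memNset// => Ay.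
  by have /(_ (conj Ay jy)) : (~` (A `&` iter_boundary A j)) y by near: y.
Unshelve. all: end_near. Qed.

End iterated_boundary.

Lemma normr_indicB_le1 {R : realType} {T : Type} (A : set T) (x y : T) :
  `|\1_A y - \1_A x| <= 1 :> R.
Proof.
by rewrite !indicE; case: (y \in A); case: (x \in A);
  rewrite ?subrr ?subr0 ?sub0r ?normrN1 ?normr1 ?normr0.
Qed.

Section oscillation_indicator.
Context {R : realType} {K : metricType R}.
Variable A : set K.
Implicit Types (m j : nat) (x : K).
Local Open Scope ereal_scope.

Lemma osc_indic_le_order m x : osc (\1_A : K -> R) m x <= m%:R%:E.
Proof.
elim: m x => [|m IHm] x //=.
apply/limf_esup_le/nearW => y; apply/limf_esup_le/nearW => z /=.
by rewrite -nat1r EFinD leeD// lee_fin normr_indicB_le1.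
Qed.

(** Since x need not lie in [iter_boundary A j], the induction hypothesis applies to all nearby
    points, at rank [j] or one lower. *)
Lemma osc_indic_le m j x : ~ iter_boundary A j.+1 x ->
  osc (\1_A : K -> R) m x <= j%:R%:E.
Proof.
elim: m j x => [|m IHm] j x xj; first by rewrite lee_fin.
apply: limf_esup_le; apply: filterS (near_notin_iter_boundary xj) => y yj /=.
apply: limf_esup_le.
have near_y : \forall z \near y,
    iter_boundary A j z -> \1_A z = \1_A y :> R.
  have [jy|njy] := pselect (iter_boundary A j y).
    exact: near_indic_iter_boundary.
  (* Here the implication holds vacuously near y. *)
  by apply: filterS (near_notin_iter_boundary njy) => z.
apply: filterS2 near_y (near_notin_iter_boundary yj) => z zy nz /=.
have [jz|] := pselect (iter_boundary A j z).
  by rewrite zy // subrr normr0 add0e IHm.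
(* Rank 0 is impossible, as [iter_boundary A 0] is the whole space; otherwise the rank drops by one
   and pays for a jump of at most 1. *)
case: j {xj yj zy nz} => [[]//|j] njz.
by rewrite -nat1r EFinD leeD ?IHm// lee_fin normr_indicB_le1.
Qed.

Lemma osc_indic_ge m j x : (j <= m)%N -> iter_boundary A j x ->
  j%:R%:E <= osc (\1_A : K -> R) m x.
Proof.
elim: m j x => [|m IHm] j x; first by rewrite leqn0 => /eqP ->.
move=> jm jx; apply: le_trans (ge_limf_esup_nbhs _ _).
move: jm; rewrite leq_eqVlt => /predU1P[jm|jm].
  rewrite {}jm in jx *; apply: limf_esup_ge => V xV.
  have [y [Vy my] yx] := iter_boundaryS_indic (R := R) jx xV.
  by exists y => //; rewrite yx -nat1r EFinD leeD2l// IHm.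
apply: le_trans (ge_limf_esup_nbhs _ _).
by rewrite subrr normr0 add0e IHm.
Qed.

End oscillation_indicator.

Theorem proposition3p10 (R : realType) (K : metricType R) (A : set K)
    (hA : closed_algebra A) (hclopen : ~ clopen A)
    (m : nat) (hm1 : (1 <= m)%N)
    (hmn : (m%:R%:E <= boundary_index R A)%E) :
  (forall (j : nat) (x : K), (j < m)%N ->
     (iter_boundary A j `\` iter_boundary A j.+1) x ->
     osc (\1_A : K -> R) m x = j%:R%:E) /\
  (forall x : K, iter_boundary A m x ->
     osc (\1_A : K -> R) m x = m%:R%:E).
Proof.
split=> [j x jm [jx njx]|x mx]; apply/eqP; rewrite eq_le; apply/andP; split.
- exact: osc_indic_le.
- exact: osc_indic_ge (ltnW jm) jx.
(* x may lie in deeper boundaries as well, so the bound must come from the order [m] and not from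
   the rank of x. *)
- exact: osc_indic_le_order.
- exact: osc_indic_ge (leqnn m) mx.
Qed.
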